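(* Assume Kriesell's conjecture for finite graphs, i.e. assume that for every positive integer $m$, every finite connected graph $H$ and every $2m$-edge-connected subset $R\subseteq V(H)$, the graph $H$ contains $m$ pairwise edge-disjoint $R$-Steiner trees. Let $F$ be a non-principal ultrafilter on $\mathbb{N}$, let $k$ be a positive integer, let $G$ be a countable connected graph and let $S\subseteq V(G)$ be a $2k$-edge-connected subset. Then $G$ has $k$ pairwise edge-disjoint subgraphs, each of which contains $S$ in its vertex set and is the $F$-limit of a sequence of trees of $G$.
   Context: All graphs are simple (no loops, no multiple edges). A subset $S\subseteq V(G)$ is $m$-edge-connected (in $G$) if for every pair of vertices $u,v\in S$ there are $m$ pairwise edge-disjoint $u$–$v$ paths in $G$ (the paths may leave $S$). A tree of $G$ is a subgraph of $G$ that is a tree. An $S$-Steiner tree of $G$ is a tree $T\subseteq G$ with $S\subseteq V(T)$. For a non-principal ultrafilter $F$ on $\mathbb{N}$ and a sequence $\langle H_n\rangle_{n\in\mathbb{N}}$ of subgraphs of $G$, the $F$-limit of $\langle H_n\rangle_n$ is the subgraph $H$ of $G$ with $V(H)=\{v\in V(G):\{n: v\in V(H_n)\}\in F\}$ and $E(H)=\{e\in E(G):\{n: e\in E(H_n)\}\in F\}$. Subgraphs are edge-disjoint if they have no common edge. *)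

(* Defs.v *)
From mathcomp Require Import all_boot.
From mathcomp Require Import boolp classical_sets cardinality filter.

Set Implicit Arguments.
Unset Strict Implicit.
Unset Printing Implicit Defensive.

Local Open Scope classical_set_scope.

(* A simple graph, possibly infinite, whose vertices are taken in an ambient
   type V.  The edge xy is present when [adj x y] holds.  A graph and its
   subgraphs have the same type [graph V]. *)
Record graph (V : choiceType) := Graph {
  vset : set V;
  adj : rel V;
  adj_sym : symmetric adj;
  adj_irr : irreflexive adj;
  adj_vset : forall x y, adj x y -> vset x }.

Definition finite_graph (V : choiceType) (G : graph V) := finite_set (vset G).

(* At most countable: finite graphs are allowed. *)
Definition countable_graph (V : choiceType) (G : graph V) :=
  countable (vset G).

Definition subgraph (V : choiceType) (H G : graph V) :=
  vset H `<=` vset G /\ forall x y, adj H x y -> adj G x y.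

(* The vertex sequence of the path is x :: p, so p = [::] is the path of
   length 0. *)
Definition is_path (V : choiceType) (G : graph V) (x y : V) (p : seq V) :=
  [/\ vset G x, path (adj G) x p, uniq (x :: p) & last x p = y].

Definition path_edge (V : choiceType) (x : V) (p : seq V) : rel V :=
  fun a b => ((a, b) \in zip (x :: p) p) || ((b, a) \in zip (x :: p) p).

Definition disjoint_edges (V : choiceType) (e f : rel V) :=
  forall x y, ~ (e x y /\ f x y).

(* The subgraphs of the family are not required to be distinct: two edgeless
   ones may coincide. *)
Definition edge_disjoint (V : choiceType) (m : nat) (H : 'I_m -> graph V) :=
  forall i j, i != j -> disjoint_edges (adj (H i)) (adj (H j)).

(* The graph with no vertex is not connected. *)
Definition connected_graph (V : choiceType) (G : graph V) :=
  vset G !=set0 /\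
  forall x y, vset G x -> vset G y -> exists p, is_path G x y p.

(* For u = v the condition holds trivially, by m copies of the path of
   length 0. *)
Definition edge_connected (V : choiceType) (G : graph V) (m : nat)
    (S : set V) :=
  forall u v, S u -> S v ->
  exists P : 'I_m -> seq V,
    (forall i, is_path G u v (P i)) /\
    (forall i j, i != j ->
       disjoint_edges (path_edge u (P i)) (path_edge u (P j))).

Definition acyclic_graph (V : choiceType) (G : graph V) :=
  forall c : seq V, 2 < size c -> ~ ucycle (adj G) c.

Definition is_tree (V : choiceType) (T : graph V) :=
  connected_graph T /\ acyclic_graph T.

Definition tree_of (V : choiceType) (G T : graph V) :=
  subgraph T G /\ is_tree T.

Definition steiner_tree (V : choiceType) (G : graph V) (S : set V)
    (T : graph V) :=
  tree_of G T /\ S `<=` vset T.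

Definition kriesell_finite : Prop :=
  forall (m : nat) (V : choiceType) (H : graph V) (R : set V),
    0 < m -> finite_graph H -> connected_graph H ->
    R `<=` vset H -> edge_connected H (2 * m) R ->
    exists T : 'I_m -> graph V,
      (forall i, steiner_tree H R (T i)) /\ edge_disjoint T.

Definition nonprincipal (T : Type) (F : set_system T) :=
  forall x, F <> principal_filter x.

(* L is the F-limit in G of the sequence H of subgraphs of G. *)
Definition is_flimit (V : choiceType) (G : graph V) (F : set_system nat)
    (H : nat -> graph V) (L : graph V) :=
  (forall v, vset L v <-> vset G v /\ F [set n | vset (H n) v]) /\
  (forall x y, adj L x y <-> adj G x y /\ F [set n | adj (H n) x y]).

(* Main.v *)
Require Import Defs.
From mathcomp Require Import all_boot.
From mathcomp Require Import boolp classical_sets cardinality filter.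

(** Write [S] as an increasing union of finite sets [A n], which is possible
    because [G] is countable.  For each [n], the [2k] edge-disjoint paths between
    the pairs of points of [A n] use finitely many vertices, and adding finitely
    many further paths gives a finite connected induced subgraph of [G] in which
    [A n] is still [2k]-edge-connected.  The finite conjecture applies there and
    yields [k] edge-disjoint trees [T n i] of [G] that contain [A n]
    ([kriesell_finite_subset]).

    Let [L i] be the [F]-limit of [T n i] as [n] varies.  A vertex of [S] lies in
    [A n] for all large [n], and a non-principal ultrafilter contains every final
    segment of the integers ([nonprincipal_tail]), so it lies in [L i].  An edge
    common to [L i] and [L j] would be an edge of [T n i] for [F]-many [n] and
    of [T n j] for [F]-many [n]; two members of [F] meet, so some single [n]
    would contradict the disjointness of the trees ([flimit_disjoint]). *)

Set Implicit Arguments.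
Unset Strict Implicit.

Local Open Scope classical_set_scope.

(** * Final segments and exhaustions *)

(** Each step of the induction removes one point [N] from the segment.  By the
    dichotomy for ultrafilters this can only fail if [[set N]] belongs to [F];
    then every member of [F] meets [[set N]], hence contains [N], and [F] is
    principal. *)
Lemma nonprincipal_tail (F : set_system nat) (F_ultra : UltraFilter F)
    (F_np : nonprincipal F) (N : nat) : F [set n | N <= n].
Proof.
elim: N => [|N IH].
  by apply: (@filterS _ F _ setT) => //; exact: filterT.
have [FN|FN] := in_ultra_setVsetC [set N] F_ultra.
  case: (F_np N); apply/seteqP; split => A.
    move=> FA; apply/principal_filterP.
    by have [_ [/= -> //]] := filter_ex (filterI FN FA).
  by move=> /principal_filterP AN; apply: filterS FN => _ ->.
apply: filterS (filterI IH FN) => n [/= le_Nn neq_nN].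
by rewrite ltn_neqAle le_Nn andbT; apply/eqP => eq_Nn; apply: neq_nN.
Qed.

(** An injection [f] of [A] into the integers gives the pieces
    [A `&` f @^-1` `I_n]. *)
Lemma countable_finite_exhaustion {T : Type} (A : set T) :
  countable A -> exists B : nat -> set T,
    [/\ forall n, finite_set (B n), forall n, B n `<=` A
      & forall x, A x -> exists N, forall n, N <= n -> B n x].
Proof.
move=> /countable_injP[f f_inj].
exists (fun n => A `&` f @^-1` `I_n); split.
- move=> n; have f_injn : {in A `&` f @^-1` `I_n &, injective f}.
    by move=> x y /[!inE] -[Ax _] [Ay _]; apply: f_inj; rewrite inE.
  rewrite -(eq_finite_set (inj_card_eq f_injn)).
  by apply: sub_finite_set (finite_II n) => _ [x [_ fx] <-].
- by move=> n x [].
- by move=> x Ax; exists (f x).+1 => n fx_n; split.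
Qed.

(** * Reduction to finite induced subgraphs *)

Definition induced {V : choiceType} (G : graph V) (W : set V) : graph V.
Proof.
refine (@Graph V (vset G `&` W)
  (fun x y => [&& adj G x y, `[< W x >] & `[< W y >]]) _ _ _).
- by move=> x y; rewrite adj_sym [in LHS]andbC [in RHS]andbC [X in X && _]andbC.
- by move=> x; rewrite adj_irr.
- by move=> x y /and3P[xy /asboolP Wx _]; split => //; exact: adj_vset xy.
Defined.

Lemma induced_subgraph {V : choiceType} (G : graph V) (W : set V) :
  subgraph (induced G W) G.
Proof. by split=> [v []|x y /and3P[]]. Qed.

Lemma subgraph_trans {V : choiceType} (G H K : graph V) :
  subgraph K H -> subgraph H G -> subgraph K G.
Proof.
move=> [vKH eKH] [vHG eHG]; split; first exact: subset_trans vKH vHG.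
by move=> x y /eKH /eHG.
Qed.

Lemma path_vset {V : choiceType} (G : graph V) (x : V) (p : seq V) :
  vset G x -> path (adj G) x p -> [set` x :: p] `<=` vset G.
Proof.
elim: p x => [|y p IH] x Gx /=.
  by move=> _ z /=; rewrite inE => /eqP ->.
move=> /andP[xy yp] z /=; rewrite inE => /predU1P[-> //|].
by apply: IH yp z; rewrite adj_sym in xy; exact: adj_vset xy.
Qed.

Lemma path_induced {V : choiceType} (G : graph V) (W : set V)
    (x : V) (p : seq V) :
  [set` x :: p] `<=` W -> path (adj G) x p -> path (adj (induced G W)) x p.
Proof.
elim: p x => [//|y p IH] x sub /= /andP[xy yp].
have Wyp : [set` y :: p] `<=` W.
  by move=> z /= zyp; apply: sub; rewrite /= in_cons zyp orbT.
have Wx : W x by apply: sub; rewrite /= mem_head.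
have Wy : W y by apply: Wyp; rewrite /= mem_head.
by rewrite xy (asboolT Wx) (asboolT Wy); exact: IH.
Qed.

Lemma is_path_induced {V : choiceType} (G : graph V) (W : set V)
    (x y : V) (p : seq V) :
  [set` x :: p] `<=` W -> is_path G x y p -> is_path (induced G W) x y p.
Proof.
move=> sub [Gx xp Up lp]; split=> //; last exact: path_induced.
by split=> //; apply: sub; rewrite /= mem_head.
Qed.

(** Going back to [r] and out again gives a walk between any two vertices;
    shortening it removes its repetitions. *)
Lemma rooted_connected {V : choiceType} (G : graph V) (r : V) :
  vset G r ->
  (forall v, vset G v -> exists2 p, path (adj G) r p & last r p = v) ->
  connected_graph G.
Proof.
move=> Gr reach; split; first by exists r.
move=> x y Gx Gy; have [p rp lp] := reach x Gx; have [q rq lq] := reach y Gy.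
have xp : path (adj G) x (rev (belast r p)).
  by rewrite -lp rev_path (eq_path (fun a b => adj_sym G b a)).
have xr : last x (rev (belast r p)) = r.
  by case: p lp {rp xp} => [//|a p] _ /=; rewrite rev_cons last_rcons.
have : last x (rev (belast r p) ++ q) = y by rewrite last_cat xr.
have : path (adj G) x (rev (belast r p) ++ q) by rewrite cat_path xp xr.
by case/shortenP => s xs Us _ ls; exists s.
Qed.

(** The set [W] is the union of one path from a fixed root to each point of
    [A]: a vertex of such a path is joined to the root by an initial segment,
    which stays in [W]. *)
Lemma finite_connected_hull {V : choiceType} (G : graph V) (A : set V) :
  connected_graph G -> finite_set A -> A `<=` vset G ->
  exists W, [/\ finite_set W, A `<=` W & connected_graph (induced G W)].
Proof.
move=> [[r Gr] conn] finA AG.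
have /choice[p pP] v : exists p, vset G v -> is_path G r v p.
  by have [/(conn _ _ Gr)[p]|nGv] := pselect (vset G v); [exists p | exists [::]].
(* The root is added separately so that [W] is nonempty even when [A] is empty. *)
pose W := [set r] `|` \bigcup_(v in A) [set` r :: p v].
have sub v : A v -> [set` r :: p v] `<=` W by move=> Av z vz; right; exists v.
exists W; split.
- rewrite finite_setU; split; first exact: finite_set1.
  by apply: bigcup_finite => // v _; exact: finite_seq.
- move=> v Av; apply: (sub v Av) => /=.
  by have [_ _ _ {1}<-] := pP v (AG v Av); exact: mem_last.
apply: (@rooted_connected _ _ r) => [|v [Gv]]; first by split=> //; left.
case=> [/= ->|[a Aa] /= va]; first by exists [::].
have [_ rp _ _] := pP a (AG a Aa).
have := path_induced (sub a Aa) rp.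
by case/splitPl: va => p1 p2 lp1; rewrite cat_path => /andP[rp1 _]; exists p1.
Qed.

(** Edge-connectedness of a finite set is witnessed by finitely many paths.
    Quantifying over all larger [W'] leaves room to enlarge the vertex set
    afterwards so that the induced subgraph becomes connected. *)
Lemma edge_connected_finite {V : choiceType} (G : graph V) (m : nat)
    (A : set V) :
  finite_set A -> A `<=` vset G -> edge_connected G m A ->
  exists W, [/\ finite_set W, W `<=` vset G &
    forall W', W `<=` W' -> edge_connected (induced G W') m A].
Proof.
move=> finA AG econn.
have /choice[P PP] uv : exists P : 'I_m -> seq V, A uv.1 -> A uv.2 ->
    (forall i, is_path G uv.1 uv.2 (P i)) /\
    (forall i j, i != j ->
       disjoint_edges (path_edge uv.1 (P i)) (path_edge uv.1 (P j))).
  have [[Au Av]|nA] := pselect (A uv.1 /\ A uv.2); last first.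
    by exists (fun=> [::]) => Au Av; case: nA.
  by have [P PP] := econn _ _ Au Av; exists P.
exists (\bigcup_(u in A) \bigcup_(v in A) \bigcup_(i in [set: 'I_m])
  [set` u :: P (u, v) i]); split.
- do 2! (apply: bigcup_finite => // ? _).
  by apply: bigcup_finite => // i _; exact: finite_seq.
- move=> z [u Au [v Av [i _]]].
  by have [/(_ i)[Gu up _ _] _] := PP (u, v) Au Av; exact: path_vset.
move=> W' sub u v Au Av; have [Ppath Pdisj] := PP (u, v) Au Av.
exists (P (u, v)); split=> // i; apply: is_path_induced (Ppath i).
by move=> z zP; apply: sub; exists u => //; exists v => //; exists i.
Qed.

(** The finite conjecture extends to finite subsets of arbitrary connected graphs: the
    paths witnessing connectivity, and then the Steiner trees, live in a finite
    connected induced subgraph. *)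
Lemma kriesell_finite_subset (kriesell : kriesell_finite) (k : nat)
    (k_gt0 : 0 < k) {V : choiceType} (G : graph V) (A : set V) :
  connected_graph G -> finite_set A -> A `<=` vset G ->
  edge_connected G (2 * k) A ->
  exists T : 'I_k -> graph V,
    (forall i, steiner_tree G A (T i)) /\ edge_disjoint T.
Proof.
move=> Gconn finA AG econn.
have [W0 [finW0 W0G W0conn]] := edge_connected_finite finA AG econn.
have finWA : finite_set (A `|` W0) by rewrite finite_setU.
have WAG : A `|` W0 `<=` vset G by rewrite subUset.
have [W [finW]] := finite_connected_hull Gconn finWA WAG.
rewrite subUset => -[AW W0W] Wconn.
have finG : finite_graph (induced G W) by apply: sub_finite_set finW => v [].
have AGW : A `<=` vset (induced G W) by move=> v Av; split; [exact: AG|exact: AW].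
have [T [Tst Tdisj]] := kriesell k V _ A k_gt0 finG Wconn AGW (W0conn W W0W).
exists T; split=> // i; have [[TG Ttree] AT] := Tst i.
by split=> //; split=> //; exact: subgraph_trans TG (induced_subgraph G W).
Qed.

(** * Limits along a filter *)

Definition flimit {V : choiceType} (G : graph V) (F : set_system nat)
    (F_filter : Filter F) (H : nat -> graph V) : graph V.
Proof.
refine (@Graph V [set v | vset G v /\ F [set n | vset (H n) v]]
  (fun x y => adj G x y && `[< F [set n | adj (H n) x y] >]) _ _ _).
- move=> x y; rewrite adj_sym; congr (_ && `[< F _ >]).
  by apply/seteqP; split=> n /=; rewrite adj_sym.
- by move=> x; rewrite adj_irr.
- move=> x y /andP[xy /asboolP Fxy]; split; first exact: adj_vset xy.
  by apply: filterS Fxy => n; exact: adj_vset.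
Defined.

Lemma flimitP {V : choiceType} (G : graph V) (F : set_system nat)
    (F_filter : Filter F) (H : nat -> graph V) :
  is_flimit G F H (flimit G F_filter H).
Proof.
split=> // x y; split=> [/andP[xy /asboolP]|[xy Fxy]] //=.
by rewrite xy; apply/asboolP.
Qed.

Lemma flimit_subgraph {V : choiceType} (G L : graph V) (F : set_system nat)
    (H : nat -> graph V) : is_flimit G F H L -> subgraph L G.
Proof. by move=> [vL eL]; split=> [v /vL[]|x y /eL[]]. Qed.

(** An edge of both limits would be, for [F]-many [n], an edge of both [H n]
    and [H' n]; members of a proper filter are nonempty. *)
Lemma flimit_disjoint {V : choiceType} (G L L' : graph V)
    (F : set_system nat) (F_proper : ProperFilter F) (H H' : nat -> graph V) :
  is_flimit G F H L -> is_flimit G F H' L' ->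
  (forall n, disjoint_edges (adj (H n)) (adj (H' n))) ->
  disjoint_edges (adj L) (adj L').
Proof.
move=> [_ eL] [_ eL'] disj x y [/eL[_ Fxy] /eL'[_ Fxy']].
by have [n /disj] := filter_ex (filterI Fxy Fxy').
Qed.

(** * Edge-disjoint limits of trees *)

Unset Implicit Arguments.
Set Strict Implicit.

Theorem theorem3p2 (kriesell : kriesell_finite)
    (F : set_system nat) (F_ultra : UltraFilter F) (F_np : nonprincipal F)
    (k : nat) (k_gt0 : 0 < k)
    (V : choiceType) (G : graph V)
    (G_countable : countable_graph G) (G_connected : connected_graph G)
    (S : set V) (S_sub : S `<=` vset G) (S_conn : edge_connected G (2 * k) S) :
  exists L : 'I_k -> graph V,
    [/\ forall i, subgraph (L i) G,
        edge_disjoint L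
      & forall i, S `<=` vset (L i) /\
          exists T : nat -> graph V,
            (forall n, tree_of G (T n)) /\ is_flimit G F T (L i)].
Proof.
have S_countable : countable S := sub_countable (subset_card_le S_sub) G_countable.
have [A [A_fin A_S A_exhausts]] := countable_finite_exhaustion S_countable.
have /choice[T TP] n : exists T : 'I_k -> graph V,
    (forall i, steiner_tree G (A n) (T i)) /\ edge_disjoint T.
  apply: kriesell_finite_subset => //.
    exact: subset_trans (A_S n) S_sub.
  by move=> u v /A_S Su /A_S Sv; exact: S_conn.
have F_filter : Filter F by exact: _.
pose L i := flimit G F_filter (T^~ i).
have LP i : is_flimit G F (T^~ i) (L i) := flimitP G F_filter _.
exists L; split=> [i|i j neq_ij|i].
- exact: flimit_subgraph (LP i).
- by apply: flimit_disjoint (LP i) (LP j) _ => n; exact: (TP n).2.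
split; last by exists (T^~ i); split=> // n; have [/(_ i)[]] := TP n.
move=> v Sv; apply/(LP i).1; split; first exact: S_sub.
have [N AN] := A_exhausts v Sv.
apply: filterS (nonprincipal_tail F_ultra F_np N) => n /AN Anv.
by have [/(_ i)[_ AT] _] := TP n; exact: AT.
Qed.
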